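(* Let $G$ be a finite abelian group, written additively, and let $N_G$ denote the number of subsets $S\subseteq G$ (including the empty set, with sum $0$) such that $\sum_{\gamma\in S}\gamma=0\in G$. Let $R$ be the regular representation of $G$ over $\mathbb C$. Then $$N_G=\dim(\wedge^{\cdot}R)^G=\frac{1}{\#(G)}\sum_{d\ \mathrm{odd}}\varphi_G(d)\,2^{\#(G)/d}.$$
   Context: $\#(G)$ is the order of $G$; $\varphi_G(d)$ is the number of elements of order $d$ in $G$, so that the sum, over odd positive integers $d$, effectively runs over odd divisors of $\#(G)$. $\wedge^{\cdot}R=\bigoplus_{m\ge0}\wedge^mR$ is the exterior algebra of $R$, and $(\wedge^{\cdot}R)^G$ is its subspace of $G$-invariants. *)

(* Defs.v *)
From HB Require Import structures.
From mathcomp Require Import all_boot all_order all_algebra all_fingroup.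
From mathcomp Require Import mxrepresentation.

Set Implicit Arguments.
Unset Strict Implicit.
Unset Printing Implicit Defensive.

Import GRing.Theory.
Local Open Scope ring_scope.

(* The exterior algebra of the row space 'rV[F]_n, with basis the monomials    *)
(* e_S = e_(i1) /\ ... /\ e_(im) for S = {i1 < ... < im}; its degree m part is  *)
(* spanned by the e_S with #|S| = m. That this is the exterior algebra (in any *)
(* characteristic) is certified by its universal property: ext_iota_sqr,       *)
(* ext_lift_iota, ext_lift_monoid_morphism and ext_lift_uniq below.            *)
Definition exterior (F : fieldType) (n : nat) : Type :=
  {ffun {set 'I_n} -> F^o}.

HB.instance Definition _ (F : fieldType) (n : nat) :=
  Vector.copy (exterior F n) {ffun {set 'I_n} -> F^o}.

Section ExteriorAlgebra.

Variables (F : fieldType) (n : nat).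
Implicit Types (S T U : {set 'I_n}) (x y z : exterior F n) (i j : 'I_n).

Definition ext_base S : exterior F n := [ffun T => (T == S)%:R].

(* Number of transpositions sorting the concatenation of S and T. *)
Definition ext_inv S T : nat := \sum_(i in S) \sum_(j in T) (j < i)%N.

Definition ext_mul_base S T : exterior F n :=
  if [disjoint S & T] then (-1) ^+ ext_inv S T *: ext_base (S :|: T) else 0.

Definition ext_mul x y : exterior F n :=
  \sum_S \sum_T (x S * y T) *: ext_mul_base S T.

Lemma ext_baseE x : x = \sum_S x S *: ext_base S.
Proof.
apply/ffunP=> T; rewrite sum_ffunE (bigD1 T) //= big1 => [|S neST].
  by rewrite addr0 !ffunE eqxx /GRing.scale /= mulr1.
by rewrite !ffunE eq_sym (negPf neST) scaler0.
Qed.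

Lemma ext_mul_is_linearl y : linear (ext_mul^~ y).
Proof.
move=> a u v; rewrite /ext_mul scaler_sumr -big_split; apply: eq_bigr => S _.
rewrite scaler_sumr -big_split; apply: eq_bigr => T _ /=.
by rewrite !ffunE scalerA -scalerDl mulrDl mulrA.
Qed.

Lemma ext_mul_is_linearr x : linear (ext_mul x).
Proof.
move=> a u v; rewrite /ext_mul scaler_sumr -big_split; apply: eq_bigr => S _.
rewrite scaler_sumr -big_split; apply: eq_bigr => T _ /=.
by rewrite !ffunE scalerA -scalerDl mulrDr mulrCA.
Qed.

Let ext_mulr y x := ext_mul x y.

HB.instance Definition _ y :=
  GRing.isLinear.Build F (exterior F n) (exterior F n) _ (ext_mulr y)
    (ext_mul_is_linearl y).
HB.instance Definition _ x :=
  GRing.isLinear.Build F (exterior F n) (exterior F n) _ (ext_mul x)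
    (ext_mul_is_linearr x).

Lemma ext_mul_suml (I : Type) (r : seq I) (P : pred I) (u : I -> exterior F n) y :
  ext_mul (\sum_(k <- r | P k) u k) y = \sum_(k <- r | P k) ext_mul (u k) y.
Proof. exact: (linear_sum (ext_mulr y)). Qed.

Lemma ext_mul_sumr (I : Type) (r : seq I) (P : pred I) x (u : I -> exterior F n) :
  ext_mul x (\sum_(k <- r | P k) u k) = \sum_(k <- r | P k) ext_mul x (u k).
Proof. exact: (linear_sum (ext_mul x)). Qed.

Lemma ext_mulZl a x y : ext_mul (a *: x) y = a *: ext_mul x y.
Proof. exact: (linearZZ (ext_mulr y)). Qed.

Lemma ext_mulZr a x y : ext_mul x (a *: y) = a *: ext_mul x y.
Proof. exact: (linearZZ (ext_mul x)). Qed.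

Lemma ext_mul0l y : ext_mul 0 y = 0.
Proof. exact: (linear0 (ext_mulr y)). Qed.

Lemma ext_mul0r x : ext_mul x 0 = 0.
Proof. exact: (linear0 (ext_mul x)). Qed.

Lemma ext_mul_baseE S T : ext_mul (ext_base S) (ext_base T) = ext_mul_base S T.
Proof.
rewrite /ext_mul (bigD1 S) //= (bigD1 T) //= !ffunE !eqxx mulr1 scale1r.
rewrite !big1 ?addr0 // => U neU.
  by rewrite big1 // => V _; rewrite !ffunE (negPf neU) mul0r scale0r.
by rewrite !ffunE (negPf neU) mulr0 scale0r.
Qed.

Lemma ext_invUl S T U : [disjoint S & T] ->
  ext_inv (S :|: T) U = (ext_inv S U + ext_inv T U)%N.
Proof.
by move=> dST; rewrite /ext_inv -bigU //; apply: eq_bigl => i; rewrite !inE.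
Qed.

Lemma ext_invUr S T U : [disjoint T & U] ->
  ext_inv S (T :|: U) = (ext_inv S T + ext_inv S U)%N.
Proof.
move=> dTU; rewrite /ext_inv -big_split; apply: eq_bigr => i _ /=.
by rewrite -bigU //; apply: eq_bigl => j; rewrite !inE.
Qed.

Lemma ext_inv0l S : ext_inv set0 S = 0%N.
Proof. by rewrite /ext_inv big_set0. Qed.

Lemma ext_inv0r S : ext_inv S set0 = 0%N.
Proof. by rewrite /ext_inv big1 // => i _; rewrite big_set0. Qed.

Lemma disjoint_setUl S T U :
  [disjoint S :|: T & U] = [disjoint S & U] && [disjoint T & U].
Proof. by rewrite -!setI_eq0 setIUl setU_eq0. Qed.

Lemma disjoint_setUr S T U :
  [disjoint S & T :|: U] = [disjoint S & T] && [disjoint S & U].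
Proof. by rewrite -!setI_eq0 setIUr setU_eq0. Qed.

Lemma ext_mulA_base S T U :
  ext_mul (ext_base S) (ext_mul (ext_base T) (ext_base U))
    = ext_mul (ext_mul (ext_base S) (ext_base T)) (ext_base U).
Proof.
rewrite !ext_mul_baseE {1}/ext_mul_base [in RHS]/ext_mul_base.
case: (boolP [disjoint T & U]) => dTU; case: (boolP [disjoint S & T]) => dST;
  rewrite ?(ext_mul0l, ext_mul0r) // ?(ext_mulZr, ext_mulZl) ?ext_mul_baseE
          /ext_mul_base ?disjoint_setUl ?disjoint_setUr ?dTU ?dST ?(negPf dTU)
          ?(negPf dST) ?andbF ?scaler0 //= ?andbT.
case: ifP => dSU; last by rewrite !scaler0.
by rewrite !scalerA -!exprD ext_invUl // ext_invUr // setUA addnC -addnA.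
Qed.

Lemma ext_mulA : associative ext_mul.
Proof.
move=> x y z; rewrite [x]ext_baseE [LHS]ext_mul_suml.
rewrite [X in _ = ext_mul X z]ext_mul_suml [RHS]ext_mul_suml.
apply: eq_bigr => S _; rewrite [LHS]ext_mulZl.
rewrite [X in _ = ext_mul X z]ext_mulZl [RHS]ext_mulZl; congr (_ *: _).
rewrite [y]ext_baseE [X in ext_mul _ X = _]ext_mul_suml [LHS]ext_mul_sumr.
rewrite [X in _ = ext_mul X z]ext_mul_sumr [RHS]ext_mul_suml.
apply: eq_bigr => T _; rewrite [X in ext_mul _ X = _]ext_mulZl [LHS]ext_mulZr.
rewrite [X in _ = ext_mul X z]ext_mulZr [RHS]ext_mulZl; congr (_ *: _).
rewrite [z]ext_baseE [X in ext_mul _ X = _]ext_mul_sumr [LHS]ext_mul_sumr.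
rewrite [RHS]ext_mul_sumr; apply: eq_bigr => U _.
rewrite [X in ext_mul _ X = _]ext_mulZr [LHS]ext_mulZr [RHS]ext_mulZr.
by rewrite ext_mulA_base.
Qed.

Lemma ext_mul1l : left_id (ext_base set0) ext_mul.
Proof.
move=> x; rewrite {1}[x]ext_baseE ext_mul_sumr [RHS]ext_baseE.
apply: eq_bigr => S _; rewrite ext_mulZr ext_mul_baseE /ext_mul_base.
by rewrite -setI_eq0 set0I eqxx ext_inv0l scale1r set0U.
Qed.

Lemma ext_mul1r : right_id (ext_base set0) ext_mul.
Proof.
move=> x; rewrite {1}[x]ext_baseE ext_mul_suml [RHS]ext_baseE.
apply: eq_bigr => S _; rewrite ext_mulZl ext_mul_baseE /ext_mul_base.
by rewrite -setI_eq0 setI0 eqxx ext_inv0r scale1r setU0.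
Qed.

Lemma ext_mulDl : left_distributive ext_mul +%R.
Proof. by move=> x y z; rewrite -[RHS](linearD (ext_mulr z)). Qed.

Lemma ext_mulDr : right_distributive ext_mul +%R.
Proof. by move=> x y z; rewrite -[RHS](linearD (ext_mul x)). Qed.

Lemma ext_one_neq0 : ext_base set0 != 0.
Proof.
by apply/eqP=> /ffunP/(_ set0)/eqP; rewrite !ffunE eqxx oner_eq0.
Qed.

HB.instance Definition _ := GRing.Zmodule_isNzRing.Build (exterior F n)
  ext_mulA ext_mul1l ext_mul1r ext_mulDl ext_mulDr ext_one_neq0.

HB.instance Definition _ := GRing.Lmodule_isLalgebra.Build F (exterior F n)
  (fun a x y => esym (ext_mulZl a x y)).

HB.instance Definition _ := GRing.Lalgebra_isAlgebra.Build F (exterior F n)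
  (fun a x y => esym (ext_mulZr a x y)).

Definition ext_iota (v : 'rV[F]_n) : exterior F n :=
  \sum_i v 0 i *: ext_base [set i].

Definition ext_lift (B : algType F) (f : 'rV[F]_n -> B) x : B :=
  \sum_S x S *: \prod_(i in S) f (delta_mx 0 i).

Lemma ext_iota_is_linear : linear ext_iota.
Proof.
move=> a u v; rewrite /ext_iota scaler_sumr -big_split; apply: eq_bigr => i _.
by rewrite /= !mxE scalerA -scalerDl.
Qed.

HB.instance Definition _ :=
  GRing.isLinear.Build F 'rV[F]_n (exterior F n) _ ext_iota ext_iota_is_linear.

Lemma ext_lift_is_linear (B : algType F) (f : 'rV[F]_n -> B) :
  linear (ext_lift f).
Proof.
move=> a u v; rewrite /ext_lift scaler_sumr -big_split; apply: eq_bigr => S _.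
by rewrite /= !ffunE scalerA -scalerDl.
Qed.

HB.instance Definition _ (B : algType F) (f : 'rV[F]_n -> B) :=
  GRing.isLinear.Build F (exterior F n) B _ (ext_lift f) (ext_lift_is_linear f).

Lemma ext_lift_base (B : algType F) (f : 'rV[F]_n -> B) S :
  ext_lift f (ext_base S) = \prod_(i in S) f (delta_mx 0 i).
Proof.
rewrite /ext_lift (bigD1 S) //= [X in _ + X]big1 => [|T neTS].
  by rewrite ffunE eqxx scale1r addr0.
by rewrite ffunE (negPf neTS) scale0r.
Qed.

Lemma ext_lift_iota (B : algType F) (f : {linear 'rV[F]_n -> B}) v :
  ext_lift f (ext_iota v) = f v.
Proof.
rewrite linear_sum /= [in RHS](row_sum_delta v) linear_sum.
by apply: eq_bigr => i _; rewrite !linearZZ /= ext_lift_base big_set1.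
Qed.

Lemma ext_iota_delta i : ext_iota (delta_mx 0 i) = ext_base [set i].
Proof.
rewrite /ext_iota (bigD1 i) //= big1 => [|j neji].
  by rewrite mxE !eqxx scale1r addr0.
by rewrite mxE (negPf neji) andbF scale0r.
Qed.

Lemma sqr_sum_anti (B : algType F) (g : 'I_n -> 'I_n -> B) :
  (forall i, g i i = 0) -> (forall i j, g i j = - g j i) ->
  \sum_i \sum_j g i j = 0.
Proof.
move=> g0 gN; rewrite (eq_bigr (fun i => \sum_(j < n | (j < i)%N) g i j
  + \sum_(j < n | (i < j)%N) g i j)).
  rewrite big_split /= [X in _ + X](exchange_big_dep xpredT) //= -big_split /=.
  apply: big1 => i _; rewrite -big_split big1 // => j _ /=.
  by rewrite [g i j]gN addNr.
move=> i _; rewrite (bigID (fun j : 'I_n => (j < i)%N)) /=; congr (_ + _).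
under eq_bigl do rewrite -leqNgt.
by rewrite (bigD1 i) //= g0 add0r; apply: eq_bigl => j; rewrite [RHS]ltn_neqAle andbC eq_sym.
Qed.

Lemma ext_iota_sqr v : ext_iota v * ext_iota v = 0.
Proof.
rewrite {1}/ext_iota mulr_suml.
under eq_bigr do rewrite mulr_sumr.
apply: sqr_sum_anti => [i | i j].
  rewrite -scalerAl -scalerAr [_ * _]ext_mul_baseE /ext_mul_base.
  by rewrite -setI_eq0 setIid -cards_eq0 cards1 !scaler0.
rewrite -!scalerAl -!scalerAr !scalerA -scalerN mulrC; congr (_ *: _).
rewrite ![ext_base _ * _]ext_mul_baseE /ext_mul_base disjoint_sym.
case: ifP; last by rewrite oppr0.
rewrite disjoints1 inE /ext_inv !big_set1 setUC => neji; rewrite -scaleNr.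
congr (_ *: _); case: (ltngtP i j) => [||/ord_inj/eqP] //=.
- by rewrite ?expr0 ?expr1 ?opprK.
by rewrite eq_sym (negPf neji).
Qed.

Lemma sorted_enum_set S : sorted (fun i j => (i < j)%N) (enum S).
Proof.
rewrite /enum_mem -enumT /= sorted_filter //; first by move=> j i k /ltn_trans; apply.
by have := iota_ltn_sorted 0 n; rewrite -val_enum_ord sorted_map.
Qed.

Lemma prod_set_enum (B : nzRingType) (a : 'I_n -> B) S :
  \prod_(j in S) a j = \prod_(j <- enum S) a j.
Proof. by rewrite -[LHS]big_filter [index_enum _]unlock. Qed.

Lemma prod_set_min (B : nzRingType) (a : 'I_n -> B) i S :
  (forall j, j \in S -> (i < j)%N) ->
  \prod_(j in i |: S) a j = a i * \prod_(j in S) a j.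
Proof.
move=> ltiS; rewrite !prod_set_enum.
suff -> : enum (i |: S) = i :: enum S by rewrite big_cons.
apply: (@irr_sorted_eq _ (fun k l : 'I_n => (k < l)%N)).
- by move=> l k m /ltn_trans; apply.
- by move=> k; rewrite /= ltnn.
- exact: sorted_enum_set.
- rewrite /= path_min_sorted ?sorted_enum_set //.
  by apply/allP=> j; rewrite mem_enum => /ltiS.
by move=> j; rewrite inE !mem_enum !inE.
Qed.

Lemma set_minP S : S != set0 ->
  exists2 i, i \in S & forall j, j \in S :\ i -> (i < j)%N.
Proof.
case/set0Pn=> i0 Si0; case: (arg_minnP (@nat_of_ord n) Si0) => i Si le_i.
exists i => // j; rewrite !inE => /andP[neji Sj].
by rewrite ltn_neqAle le_i // andbT eq_sym.
Qed.

Section AlternatingMap.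

Variables (B : algType F) (f : {linear 'rV[F]_n -> B}).
Hypothesis f_sqr : forall v, f v * f v = 0.

Let a i := f (delta_mx 0 i).
Let P S := \prod_(i in S) a i.

Let a_sqr i : a i * a i = 0. Proof. exact: f_sqr. Qed.

Let a_anti i j : a i * a j = - (a j * a i).
Proof.
apply/eqP; rewrite -addr_eq0; apply/eqP.
have := f_sqr (delta_mx 0 i + delta_mx 0 j).
by rewrite linearD mulrDl !mulrDr -!/(a _) !a_sqr add0r addr0.
Qed.

Let P_set0 : P set0 = 1. Proof. by rewrite /P big_set0. Qed.

Let P_min i S : (forall j, j \in S -> (i < j)%N) -> P (i |: S) = a i * P S.
Proof. exact: prod_set_min. Qed.

Let a_P i T :
  a i * P T = if i \in T then 0
              else (-1) ^+ (\sum_(j in T) (j < i)%N) *: P (i |: T).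
Proof.
have [m] := ubnP #|T|; elim: m => // m IHm in T *; rewrite ltnS => leTm.
have [->|T_neq0] := eqVneq T set0.
  by rewrite inE big_set0 scale1r P_min // => j; rewrite inE.
have [k Tk ltk] := set_minP T_neq0.
have defT : T = k |: (T :\ k) by rewrite setD1K.
have TkN : k \notin T :\ k by rewrite !inE eqxx.
have PT : P T = a k * P (T :\ k) by rewrite {1}defT P_min.
case: (ltngtP i k) => [ltik | ltki | /ord_inj->].
- have lti j : j \in T -> (i < j)%N.
    rewrite {1}defT !inE => /predU1P[-> // | Tj].
    by apply: ltn_trans ltik _; apply: ltk; rewrite !inE.
  case: ifP => [/lti | _]; first by rewrite ltnn.
  rewrite P_min // big1 ?scale1r // => j /lti ltij.
  by rewrite ltnNge ltnW.
- have leTm' : (#|T :\ k| < m)%N by rewrite (cardsD1 k) Tk in leTm.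
  rewrite PT mulrA a_anti mulNr -mulrA IHm //.
  have -> : (i \in T :\ k) = (i \in T) by rewrite !inE -val_eqE /= gtn_eqF.
  case: ifP => _; first by rewrite mulr0 oppr0.
  rewrite [in RHS](big_setD1 k) //= ltki exprD expr1 mulN1r scaleNr -scalerAr.
  congr (- (_ *: _)); rewrite {2}defT setUCA [RHS]P_min // => j.
  by rewrite !inE => /predU1P[-> // | Tj]; apply: ltk; rewrite !inE.
by rewrite Tk PT mulrA a_sqr mul0r.
Qed.

Let P_P S T :
  P S * P T = if [disjoint S & T] then (-1) ^+ ext_inv S T *: P (S :|: T) else 0.
Proof.
have [m] := ubnP #|S|; elim: m => // m IHm in S *; rewrite ltnS => leSm.
have [->|S_neq0] := eqVneq S set0.
  by rewrite -setI_eq0 set0I eqxx ext_inv0l scale1r set0U P_set0 mul1r.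
have [k Sk ltk] := set_minP S_neq0.
have defS : S = k |: (S :\ k) by rewrite setD1K.
have kSN : k \notin S :\ k by rewrite !inE eqxx.
have leSm' : (#|S :\ k| < m)%N by rewrite (cardsD1 k) Sk in leSm.
have dS : [disjoint S & T] = (k \notin T) && [disjoint S :\ k & T].
  by rewrite {1}defS disjoint_setUl disjoints1.
have invS : ext_inv S T = (\sum_(j in T) (j < k) + ext_inv (S :\ k) T)%N.
  by rewrite {1}defS ext_invUl ?disjoints1 // {1}/ext_inv big_set1.
rewrite {1}defS P_min // -mulrA IHm // dS.
case: ifP => [dST | _]; last by rewrite andbF mulr0.
rewrite andbT -scalerAr a_P in_setU (negPf kSN) /=.
case: ifP => kT; rewrite /= ?scaler0 //.
rewrite scalerA -exprD setUA setD1K // invS addnC.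
congr (_ ^+ (_ + _) *: _); rewrite [LHS](bigID (mem T)) /= [X in (_ + X)%N]big1.
  rewrite addn0; apply: eq_bigl => j; rewrite in_setU.
  by case: (j \in T); rewrite ?andbF ?orbT.
move=> j; rewrite in_setU => /andP[/orP[/ltk ltkj _ | ->] //].
by rewrite ltnNge ltnW.
Qed.

Lemma ext_lift_monoid_morphism : monoid_morphism (ext_lift f).
Proof.
split; first by rewrite ext_lift_base big_set0.
move=> x y; rewrite [LHS]linear_sum {2}/ext_lift mulr_suml.
apply: eq_bigr => S _; rewrite linear_sum /ext_lift mulr_sumr.
apply: eq_bigr => T _; rewrite linearZZ -scalerAl -scalerAr scalerA.
congr (_ *: _); rewrite [RHS]P_P /ext_mul_base.
by case: ifP => _; rewrite ?linear0 // linearZZ /= ext_lift_base.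
Qed.

End AlternatingMap.

Lemma ext_base_prod S : ext_base S = \prod_(i in S) ext_iota (delta_mx 0 i).
Proof.
have [m] := ubnP #|S|; elim: m => // m IHm in S *; rewrite ltnS => leSm.
have [->|S_neq0] := eqVneq S set0; first by rewrite big_set0.
have [k Sk ltk] := set_minP S_neq0.
rewrite -(setD1K Sk) prod_set_min // -IHm; last first.
  by rewrite (cardsD1 k) Sk in leSm.
rewrite ext_iota_delta [RHS]ext_mul_baseE /ext_mul_base disjoints1 !inE eqxx /=.
rewrite /ext_inv big_set1 big1 ?scale1r // => j /ltk ltkj.
by rewrite ltnNge ltnW.
Qed.

Lemma ext_lift_uniq (B : algType F) (h : {lrmorphism exterior F n -> B}) x :
  h x = ext_lift (h \o ext_iota) x.
Proof.
rewrite {1}[x]ext_baseE linear_sum; apply: eq_bigr => S _.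
by rewrite linearZZ ext_base_prod rmorph_prod.
Qed.

End ExteriorAlgebra.

(* The functorial action on the exterior algebra: the algebra endomorphism      *)
(* that extends v |-> v *m M.                                                  *)
Section ExteriorMap.

Variables (F : fieldType) (n : nat) (M : 'M[F]_n).

Definition ext_map : exterior F n -> exterior F n :=
  ext_lift (fun v => ext_iota (v *m M)).

Lemma ext_map_is_linear : linear ext_map.
Proof. exact: ext_lift_is_linear. Qed.

HB.instance Definition _ :=
  GRing.isLinear.Build F (exterior F n) (exterior F n) _ ext_map
    ext_map_is_linear.

Lemma ext_map_is_monoid_morphism : monoid_morphism ext_map.
Proof.
apply: (@ext_lift_monoid_morphism F n (exterior F n)
          (@ext_iota F n \o mulmxr M)) => v.
exact: ext_iota_sqr.
Qed.

HB.instance Definition _ :=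
  GRing.isMonoidMorphism.Build (exterior F n) (exterior F n) ext_map
    ext_map_is_monoid_morphism.

Lemma ext_map_iota v : ext_map (ext_iota v) = ext_iota (v *m M).
Proof.
exact: (@ext_lift_iota F n (exterior F n) (@ext_iota F n \o mulmxr M)).
Qed.

End ExteriorMap.

Definition ext_invariants (F : fieldType) (gT : finGroupType) (G : {group gT})
    (n : nat) (rG : mx_representation F G n) : {vspace exterior F n} :=
  (\bigcap_(g in G) fixedSpace (linfun (ext_map (rG g))))%VS.

Lemma ext_invariantsP (F : fieldType) (gT : finGroupType) (G : {group gT})
    (n : nat) (rG : mx_representation F G n) (x : exterior F n) :
  reflect {in G, forall g, ext_map (rG g) x = x} (x \in ext_invariants rG).
Proof.
apply: (iffP subv_bigcapP) => [fix_x g Gg | fix_x g Gg].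
  by have /fixedSpaceP := fix_x g Gg; rewrite lfunE.
by apply/fixedSpaceP; rewrite lfunE /= fix_x.
Qed.

Definition num_zero_sum_subsets (G : finZmodType) : nat :=
  #|[set S : {set G} | \sum_(x in S) x == 0]|.

(* The order #[x] is taken in the additive group of G. *)
Definition num_elements_of_order (G : finZmodType) (d : nat) : nat :=
  #|[set x : G | #[x]%g == d]|.

(* Main.v *)
(* Fix a symmetric nondegenerate pairing b : G x G -> C^*; it identifies G with
   its dual. The vectors v_y = sum_x b(y, -x) e_x diagonalise R, with g acting
   on v_y by b(g, y), so the wedge of the v_y over y in S is an eigenvector of
   eigenvalue b(g, sum S): the invariants have the zero-sum subsets as a basis.
   Orthogonality and expansion of the product give
   #(G) N_G = sum_g sum_S b(g, sum S) = sum_g prod_y (1 + b(g, y)). The factors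
   b(g, y) run over the d-th roots of unity, d the order of g, each taken
   #(G)/d times, and prod_(z^d = 1) (1 + z) = 1 - (-1)^d. *)
Require Import Defs.
From mathcomp Require Import all_boot all_order all_algebra all_fingroup.
From mathcomp Require Import all_solvable all_field.
From mathcomp Require Import mxrepresentation complex reals.

Set Implicit Arguments.
Unset Strict Implicit.
Unset Printing Implicit Defensive.

Import GRing.Theory Num.Theory.
Local Open Scope ring_scope.

(** * Symmetric nondegenerate pairings on finite abelian groups *)

Lemma closed_prim_root_exists (F : closedFieldType) n :
  n%:R != 0 :> F -> exists z : F, n.-primitive_root z.
Proof.
move=> nz_n; have n_gt0: (0 < n)%N by case: n nz_n; rewrite ?eqxx.
have [r Dp] := closed_field_poly_normal ('X^n - 1 : {poly F}).
rewrite (monicP _) ?monicXnsubC // scale1r in Dp.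
have rn1: all n.-unity_root r by apply/allP=> z; rewrite -root_prod_XsubC -Dp.
(* Since [n] is nonzero in [F], [X^n - 1] is separable; its [n] distinct roots must then include a
   primitive one. *)
have Ur: uniq r by rewrite -separable_prod_XsubC -Dp separable_Xn_sub_1.
have sz_r: (n <= size r)%N.
  by rewrite -ltnS -(size_prod_XsubC r id) -Dp size_XnsubC.
by have [z _ pr_z] := hasP (has_prim_root n_gt0 rn1 Ur sz_r); exists z.
Qed.

(** Relative to a subset [A], so that all direct factors of a group can be treated inside one
    ambient type. *)
Definition symmetric_pairing (F : fieldType) (gT : finGroupType) (A : {set gT})
    (b : gT -> gT -> F) :=
  [/\ {in A &, forall x y, b x y = b y x},
      {in A & &, forall x y z, b (x * y)%g z = b x z * b y z},
      {in A, forall x, b x 1%g = 1}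
    & {in A, forall x, {in A, forall y, b x y = 1} -> x = 1%g}].

(** With [z] a primitive root of unity of order [#[x]], the pairing sends [x ^+ i] and [x ^+ j] to
    [z ^+ (i * j)]; pairing with the generator [x] already detects every element. *)
Lemma cycle_symmetric_pairing (F : closedFieldType) (gT : finGroupType)
    (x : gT) :
  #[x]%g%:R != 0 :> F -> exists b : gT -> gT -> F, symmetric_pairing <[x]>%g b.
Proof.
case/closed_prim_root_exists=> z pr_z.
have log_ex y : exists i, (y \in <[x]>%g) ==> (y == x ^+ i)%g.
  (* Off the cycle the exponent 0 is a dummy value. *)
  by case: cycleP => [[i ->]|_]; [exists i; rewrite eqxx | exists 0%N].
pose lg y := xchoose (log_ex y).
have lgK y : y \in <[x]>%g -> (x ^+ lg y)%g = y.
  by move=> xy; have /implyP/(_ xy)/eqP := xchooseP (log_ex y).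
(* Powers of [z] depend only on exponents modulo [#[x]], so the arbitrary choice of logarithms [lg]
   does not matter. *)
have eq_z i j : (x ^+ i = x ^+ j)%g -> z ^+ i = z ^+ j.
  by move/eqP; rewrite eq_expg_mod_order -(eq_prim_root_expr pr_z) => /eqP.
exists (fun y t => z ^+ (lg y * lg t)).
split=> [y t _ _ | y t u xy xt xu | y xy | y xy].
- by rewrite mulnC.
- rewrite -exprD -mulnDl; apply: eq_z.
  by rewrite !expgM expgD !lgK // groupM.
- by rewrite -(expr0 z); apply: eq_z; rewrite mulnC expgM lgK ?group1 // expg1n.
move=> /(_ x (cycle_id x))/eqP; rewrite mulnC -(expr0 z).
rewrite (eq_prim_root_expr pr_z) -eq_expg_mod_order expgM.
by rewrite lgK ?cycle_id // lgK // => /eqP.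
Qed.

(** Multiply the pairings of the two components. Testing against elements of one factor only
    isolates that component, which gives nondegeneracy. *)
Lemma dprod_symmetric_pairing (F : fieldType) (gT : finGroupType)
    (A B G : {group gT}) (bA bB : gT -> gT -> F) :
    (A \x B = G)%g -> symmetric_pairing A bA -> symmetric_pairing B bB ->
  exists b : gT -> gT -> F, symmetric_pairing G b.
Proof.
move=> defG [symA MA A1 ndA] [symB MB B1 ndB].
have [_ defAB cAB tiAB] := dprodP defG.
have coAB : B \in [complements to A in G]%g by apply/complP.
have nAG : (A <| G)%g by have [] := dprod_normal2 defG.
have GA x : x \in G -> divgr A B x \in A by rewrite -defAB; apply: mem_divgr.
have GB x : x \in G -> remgr A B x \in B by rewrite -defAB; apply: mem_remgr.
have sAG := normal_sub nAG.
have sBG : B \subset G by rewrite -defAB mulG_subr.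
exists (fun x y =>
  bA (divgr A B x) (divgr A B y) * bB (remgr A B x) (remgr A B y)).
split=> [x y Gx Gy | x y z Gx Gy Gz | x Gx | x Gx x1].
- by rewrite symA ?GA // symB ?GB.
- by rewrite (divgrM coAB) // (remgrM coAB) // MA ?GA // MB ?GB // mulrACA.
- rewrite (divgr_id _ (group1 A)) (remgr1 _ (group1 A)).
  by rewrite A1 ?GA // B1 ?GB // mulr1.
have xA1 : divgr A B x = 1%g.
  apply: ndA (GA x Gx) _ => y Ay; have := x1 y (subsetP sAG y Ay).
  by rewrite (divgr_id _ Ay) (remgr1 _ Ay) B1 ?GB // mulr1.
have xB1 : remgr A B x = 1%g.
  apply: ndB (GB x Gx) _ => y By; have := x1 y (subsetP sBG y By).
  rewrite (remgr_id tiAB By) -{1}[y]mul1g (divgrMid tiAB _ By) ?group1 //.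
  by rewrite A1 ?GA // mul1r.
by rewrite (divgr_eq A B x) xA1 xB1 mulg1.
Qed.

(** Induction on a decomposition into cyclic factors; the order being nonzero in [F] passes to every
    factor. *)
Lemma abelian_symmetric_pairing (F : closedFieldType) (gT : finGroupType)
    (G : {group gT}) :
    abelian G -> #|G|%:R != 0 :> F ->
  exists b : gT -> gT -> F, symmetric_pairing G b.
Proof.
move=> abG; have [s defG _] := abelian_structure abG.
elim: s G {abG} defG => [|x s IHs] G.
  rewrite big_nil => <- _; exists (fun _ _ => 1).
  by split=> // [x y z _ _ _|x /set1gP->]; rewrite ?mulr1.
rewrite big_cons => defG; have [[_ B _ defB] _ _ _] := dprodP defG.
rewrite -(dprod_card defG) natrM mulf_eq0 negb_or defB => /andP[nz_x nz_B].
have [bA] := cycle_symmetric_pairing nz_x.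
have [bB] := IHs B defB nz_B.
by rewrite defB in defG => pB pA; apply: dprod_symmetric_pairing defG pA pB.
Qed.

(** * Products of [1 + z] over roots of unity and over character values *)

Lemma prod_one_add_roots (F : fieldType) (d : nat) (s : seq F) :
    (0 < d)%N -> uniq s -> size s = d -> all d.-unity_root s ->
  \prod_(z <- s) (1 + z) = if odd d then 2 else 0.
Proof.
move=> d_gt0 Us sz_s s1.
have := @all_roots_prod_XsubC _ ('X^d - 1) s.
rewrite size_XnsubC // sz_s uniq_rootsE => /(_ erefl s1 Us).
(* Evaluating [X^d - 1] and its factorisation at -1 gives [(-1)^d - 1 = (-1)^d * prod (1 + z)]. *)
rewrite (monicP _) ?monicXnsubC // scale1r => /(congr1 (horner^~ (-1))).
rewrite !hornerE horner_prod.
under eq_bigr do rewrite !hornerE -opprD -mulN1r.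
rewrite big_split /= big_const_seq count_predT iter_mulr_1 sz_s -signr_odd.
case: (odd d); rewrite /= ?expr1 ?expr0 ?mul1r ?subrr ?mulN1r // => /esym/eqP.
by rewrite -opprD eqr_opp => /eqP.
Qed.

(* The value set s of f is permuted by multiplication by any f y, so
   f y ^+ size s = 1: thus d divides size s, while size s <= d because s
   consists of d-th roots of unity. *)
Lemma prod_one_add_char (F : fieldType) (gT : finGroupType) (f : gT -> F) d :
    (0 < d)%N -> f 1%g = 1 -> {morph f : x y / (x * y)%g >-> x * y} ->
    (forall k, reflect (forall y, f y ^+ k = 1) (d %| k)%N) ->
  \prod_y (1 + f y) = if odd d then 2 ^+ (#|gT| %/ d) else 0.
Proof.
move=> d_gt0 f1 fM fX; pose s := undup (codom f).
have Us : uniq s by apply: undup_uniq.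
have sP z : reflect (exists y, z = f y) (z \in s).
  by rewrite mem_undup; apply: (iffP codomP).
have f_neq0 y : f y != 0.
  apply/eqP=> fy0; have /eqP := fM y y^-1%g.
  by rewrite mulgV f1 fy0 mul0r oner_eq0.
have s1 : all d.-unity_root s.
  by apply/allP=> _ /sP[y ->]; apply/unity_rootP; apply: (fX d).
have le_s_d : (size s <= d)%N by apply: max_unity_roots.
have dv_d_s : (d %| size s)%N.
  apply/fX=> y.
  have s_stable : perm_eq [seq f y * z | z <- s] s.
    have Uys : uniq [seq f y * z | z <- s].
      by rewrite map_inj_uniq //; apply: mulfI.
    apply: uniq_perm => //.
    apply: (uniq_min_size Uys _ _).2; last by rewrite size_map.
    by move=> _ /mapP[_ /sP[t ->] ->]; apply/sP; exists (y * t)%g; rewrite fM.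
  have nz_s : \prod_(z <- s) z != 0.
    by rewrite prodf_seq_neq0; apply/allP=> _ /sP[t ->]; apply: f_neq0.
  apply: (mulIf nz_s); rewrite mul1r -[RHS](perm_big _ s_stable) big_map.
  by rewrite big_split /= big_const_seq count_predT iter_mulr_1.
have sz_s : size s = d.
  apply/eqP; rewrite eqn_leq le_s_d dvdn_leq // lt0n size_eq0.
  by apply/eqP=> s0; have /sP: exists y, 1 = f y by [exists 1%g]; rewrite s0.
pose k := #|[pred y | f y == 1]|.
(* Translation by [y] carries the fibre of [f] over 1 to the fibre over [f y], so all fibres have
   size [k]. *)
have count_f z : z \in s -> count_mem z (codom f) = k.
  case/sP=> y ->; rewrite count_map -sum1_count big_enum_cond /= /k -sum1_card.
  rewrite (reindex_inj (mulgI y)); apply: eq_bigl => t /=.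
  by rewrite fM -{2}[f y]mulr1 (inj_eq (mulfI (f_neq0 y))).
have card_k : (d * k)%N = #|gT|.
  rewrite -(size_codom f) -sum1_size -big_undup_iterop_count -/s.
  rewrite (eq_big_seq (fun=> k)) => [|z /count_f->].
    by rewrite big_const_seq count_predT sz_s iter_addn_0 mulnC.
  by rewrite Monoid.iteropE iter_addn_0 mul1n.
(* For even [d] the product becomes [0 ^+ k], which vanishes only if [k] is positive. *)
have k_gt0 : (0 < k)%N by apply/card_gt0P; exists 1%g; rewrite inE f1 eqxx.
rewrite -card_k mulKn // -(big_image _ _ f _ (fun z => 1 + z)).
rewrite -big_undup_iterop_count -/s.
rewrite (eq_big_seq (fun z => (1 + z) ^+ k)) => [|z /count_f->] //.
rewrite prodrXl (prod_one_add_roots d_gt0 Us sz_s s1); case: odd => //.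
by rewrite expr0n eqn0Ngt k_gt0.
Qed.

(** * Counting zero-sum subsets with a perfect pairing *)

Definition perfect_pairing (F : fieldType) (G : finZmodType)
    (b : G -> G -> F) :=
  [/\ forall x y, b x y = b y x,
      forall x y z, b (x + y) z = b x z * b y z,
      forall x, b x 0 = 1
    & forall x, (forall y, b x y = 1) -> x = 0].

Lemma perfect_pairing_exists (F : closedFieldType) (G : finZmodType) :
  #|G|%:R != 0 :> F -> exists b : G -> G -> F, perfect_pairing b.
Proof.
rewrite -cardsT => nzG.
have [b [sym_b Mb b1 nd_b]] :=
  abelian_symmetric_pairing (FinRing.zmod_abelian [set: G]) nzG.
exists b; split=> [x y | x y z | x | x x1].
- by rewrite sym_b ?inE.
- by rewrite -Mb ?inE.
- by rewrite -(b1 x) ?inE.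
by apply: (nd_b x) => [|y _]; rewrite ?inE.
Qed.

Section PerfectPairing.

Variables (F : fieldType) (G : finZmodType) (b : G -> G -> F).
Hypothesis perf_b : perfect_pairing b.

Lemma pairingC x y : b x y = b y x. Proof. by case: perf_b. Qed.

Lemma pairingDl x y z : b (x + y) z = b x z * b y z.
Proof. by case: perf_b. Qed.

Lemma pairingDr x y z : b x (y + z) = b x y * b x z.
Proof. by rewrite !(pairingC x) pairingDl. Qed.

Lemma pairing0r x : b x 0 = 1. Proof. by case: perf_b. Qed.

Lemma pairing0l x : b 0 x = 1. Proof. by rewrite pairingC pairing0r. Qed.

Lemma pairing_nondegenerate x : (forall y, b x y = 1) -> x = 0.
Proof. by case: perf_b => _ _ _; apply. Qed.

Lemma pairing_neq0 x y : b x y != 0.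
Proof.
apply/eqP=> b0; have /eqP := pairing0r x.
by rewrite -(subrr y) pairingDr b0 mul0r eq_sym oner_eq0.
Qed.

Lemma pairingNC x y : b x (- y) = b (- x) y.
Proof.
apply: (mulIf (pairing_neq0 x y)).
by rewrite -pairingDr -pairingDl !addNr pairing0l pairing0r.
Qed.

Lemma pairingMnl x y k : b (x *+ k) y = b x y ^+ k.
Proof.
by elim: k => [|k IHk]; rewrite ?mulr0n ?pairing0l // mulrS exprS pairingDl IHk.
Qed.

Lemma pairing_sumr x (I : Type) (r : seq I) (P : pred I) (y : I -> G) :
  b x (\sum_(i <- r | P i) y i) = \prod_(i <- r | P i) b x (y i).
Proof. by apply: (big_morph _ (pairingDr x) (pairing0r x)). Qed.

(** If [b x y != 1] for some [y], translating the summation variable by [y] multiplies the sum by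
    [b x y], so the sum is zero. *)
Lemma pairing_orthogonality x :
  \sum_y b x y = if x == 0 then #|G|%:R else 0.
Proof.
case: eqP => [-> | nz_x].
  by under eq_bigr do rewrite pairing0l; rewrite sumr_const.
have /existsP[y nz_y] : [exists y, b x y != 1].
  apply: contra_notT nz_x => /existsPn b1; apply: pairing_nondegenerate => y.
  exact/eqP/negPn/b1.
apply: (mulfI (_ : b x y - 1 != 0)); first by rewrite subr_eq0.
rewrite mulr0 mulrBl mul1r [X in _ - X](reindex_inj (addrI y)) mulr_sumr.
by rewrite -sumrB big1 // => z _; rewrite pairingDr subrr.
Qed.

(** By nondegeneracy the character [b x] has the same order as [x]. *)
Lemma prod_one_add_pairing x :
  \prod_y (1 + b x y) = if odd #[x]%g then 2 ^+ (#|G| %/ #[x]%g) else 0.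
Proof.
apply: prod_one_add_char => [| | y z | k]; rewrite ?order_gt0 ?pairing0r //.
  exact: pairingDr.
rewrite order_dvdn; apply: (iffP eqP) => [xk1 y | xk1].
  by rewrite -pairingMnl -FinRing.zmodXgE xk1 pairing0l.
by apply: pairing_nondegenerate => y; rewrite FinRing.zmodXgE pairingMnl.
Qed.

Lemma card_zero_sum_subsets_pairing :
  #|G|%:R * (num_zero_sum_subsets G)%:R
    = \sum_(x : G) (if odd #[x]%g then 2 ^+ (#|G| %/ #[x]%g) else 0) :> F.
Proof.
transitivity (\sum_x \sum_(S : {set G}) b x (\sum_(y in S) y)).
  rewrite exchange_big /=; under eq_bigr => S _.
    under eq_bigr do rewrite pairingC; rewrite pairing_orthogonality; over.
  by rewrite -big_mkcond sumr_const mulr_natr /num_zero_sum_subsets cardsE.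
apply: eq_bigr => x _; rewrite -prod_one_add_pairing.
(* [bigA_distr] takes the first summand at indices inside [S], so [b x y] has to come before 1. *)
under [RHS]eq_bigr do rewrite addrC.
rewrite bigA_distr /=; apply: eq_bigr => S _.
by rewrite pairing_sumr -big_mkcond.
Qed.

End PerfectPairing.

(** * Invariants of the exterior algebra from a simultaneous eigenbasis *)

Section ExteriorFunctor.

Variables (F : fieldType) (n : nat).
Implicit Types (M N : 'M[F]_n) (S : {set 'I_n}) (x : exterior F n).

Lemma ext_map_base M S :
  ext_map M (ext_base F S) = \prod_(i in S) ext_iota (row i M).
Proof. by rewrite [LHS]ext_lift_base; apply: eq_bigr => i _; rewrite -rowE. Qed.

Lemma ext_mapM M N x : ext_map (M *m N) x = ext_map N (ext_map M x).
Proof.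
rewrite [x]ext_baseE (linear_sum (ext_map M)) (linear_sum (ext_map N)).
rewrite (linear_sum (ext_map (M *m N))); apply: eq_bigr => S _ /=.
rewrite !linearZZ /= !ext_map_base rmorph_prod; congr (_ *: _).
by apply: eq_bigr => i _; rewrite [RHS]ext_map_iota row_mul.
Qed.

Lemma ext_map_diag_base (d : 'rV[F]_n) S :
  ext_map (diag_mx d) (ext_base F S) = (\prod_(i in S) d 0 i) *: ext_base F S.
Proof.
rewrite ext_map_base ext_base_prod -scaler_prod; apply: eq_bigr => i _.
by rewrite -linearZZ row_diag_mx.
Qed.

Lemma ext_map1 x : ext_map 1%:M x = x.
Proof.
rewrite [x]ext_baseE (linear_sum (ext_map _)); apply: eq_bigr => S _.
rewrite linearZZ /= ext_map_base ext_base_prod; congr (_ *: _).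
by apply: eq_bigr => i _; rewrite row1.
Qed.

Lemma ext_map_diag (d : 'rV[F]_n) x S :
  ext_map (diag_mx d) x S = (\prod_(i in S) d 0 i) * x S.
Proof.
rewrite {1}[x]ext_baseE (linear_sum (ext_map _)) sum_ffunE (bigD1 S) //=.
rewrite big1 => [|T neTS].
  rewrite linearZZ /= ext_map_diag_base !ffunE eqxx /GRing.scale /=.
  by rewrite addr0 mulr1 mulrC.
rewrite linearZZ /= ext_map_diag_base !ffunE eq_sym (negPf neTS).
by rewrite /GRing.scale /= !mulr0.
Qed.

Lemma mem_span_ext_base (s : seq {set 'I_n}) x :
  reflect (forall S, S \notin s -> x S = 0)
    (x \in <<[seq ext_base F T | T <- s]>>%VS).
Proof.
apply: (iffP idP) => [|x0].
  elim: s x => [|T s IHs] x.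
    by rewrite span_nil memv0 => /eqP-> S _; rewrite ffunE.
  rewrite span_cons => /memv_addP[_ /vlineP[k ->] [y /IHs y0 ->]] S.
  rewrite inE negb_or => /andP[neST /y0 yS].
  by rewrite !ffunE yS (negPf neST) scaler0 addr0.
rewrite [x]ext_baseE rpred_sum // => S _.
case: (boolP (S \in s)) => [sS | /x0->]; last by rewrite scale0r mem0v.
by rewrite rpredZ // memv_span // map_f.
Qed.

Lemma free_ext_base (s : seq {set 'I_n}) :
  uniq s -> free [seq ext_base F T | T <- s].
Proof.
elim: s => [|S s IHs] /=; first by rewrite nil_free.
case/andP=> sS /IHs free_s; rewrite free_cons free_s andbT.
apply/negP=> /mem_span_ext_base/(_ S sS)/eqP.
by rewrite ffunE eqxx oner_eq0.
Qed.

End ExteriorFunctor.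

(** The rows of [P] are common eigenvectors, so [ext_map P] carries the fixed space of the diagonal
    action isomorphically onto the invariants. A diagonal action scales each monomial, hence its
    fixed space is spanned by the monomials with all eigenvalues 1. *)
Lemma dim_ext_invariants_diag (F : fieldType) (gT : finGroupType)
    (G : {group gT}) (n : nat) (rG : mx_representation F G n) (P : 'M[F]_n)
    (d : gT -> 'rV[F]_n) :
    P \in unitmx -> {in G, forall g, P *m rG g = diag_mx (d g) *m P} ->
  \dim (ext_invariants rG)
    = #|[set S : {set 'I_n} | [forall g in G, \prod_(i in S) d g 0 i == 1]]|.
Proof.
move=> uP PrG; set Z := [set S | _].
pose V := <<[seq ext_base F T | T <- enum Z]>>%VS.
pose f := linfun (ext_map P).
have fK : cancel (ext_map P) (ext_map (invmx P)).
  by move=> x; rewrite -ext_mapM mulmxV // ext_map1.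
have Kf : cancel (ext_map (invmx P)) (ext_map P).
  by move=> x; rewrite -ext_mapM mulVmx // ext_map1.
have memV x : reflect {in G, forall g, ext_map (diag_mx (d g)) x = x} (x \in V).
  apply: (iffP (mem_span_ext_base _ _)) => [x0 g Gg | fix_x S].
    apply/ffunP=> S; rewrite ext_map_diag.
    have [ZS | /x0->] := boolP (S \in enum Z).
      move: ZS; rewrite mem_enum inE => /forall_inP/(_ g Gg)/eqP->.
      by rewrite mul1r.
    by rewrite mulr0.
  (* If some [g] scales the monomial of [S] by a factor other than 1, the coordinate of a fixed
     vector at [S] must vanish. *)
  rewrite mem_enum inE => /forall_inPn[g Gg neq1].
  apply/eqP; have := congr1 (fun y : exterior F n => y S) (fix_x g Gg).
  move/eqP; rewrite /= ext_map_diag -subr_eq0 -{2}[x S]mul1r -mulrBl mulf_eq0.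
  by rewrite subr_eq0 (negPf neq1).
suff -> : ext_invariants rG = (f @: V)%VS.
  rewrite limg_dim_eq.
    by rewrite (eqP (free_ext_base _ (enum_uniq Z))) size_map cardE.
  apply/eqP; rewrite -subv0; apply/subvP=> x.
  rewrite memv_cap memv_ker lfunE memv0 => /andP[_ /eqP fx0].
  by rewrite -[x]fK [X in ext_map _ X]fx0 linear0.
have eq_fix x g : g \in G ->
    ext_map (rG g) (ext_map P x) = ext_map P (ext_map (diag_mx (d g)) x).
  by move=> Gg; rewrite -!ext_mapM PrG.
apply/vspaceP=> x; apply/ext_invariantsP/idP; last first.
  by case/memv_imgP=> y /memV fix_y -> g Gg; rewrite lfunE /= eq_fix // fix_y.
move=> fix_x; rewrite -[x]Kf -(lfunE (ext_map P)) memv_img //.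
by apply/memV=> g Gg; apply: (can_inj fK); rewrite -eq_fix // !Kf fix_x.
Qed.

Lemma dim_ext_invariants_regular (F : fieldType) (G : finZmodType)
    (b : G -> G -> F) :
    perfect_pairing b -> #|G|%:R != 0 :> F ->
  \dim (ext_invariants (regular_repr F [set: G]%G)) = num_zero_sum_subsets G.
Proof.
move=> perf_b nzG; set rG := regular_repr F _.
pose ev (i : 'I_#|[set: G]|) : G := enum_val i.
pose ix : G -> 'I_#|[set: G]| := gring_index [set: G]%G.
have evK : cancel ev ix by apply: gring_valK.
have ixK : cancel ix ev by move=> x; rewrite /ev /ix gring_indexK ?inE.
have ev_bij : bijective ev by exists ix.
(* Row [i] of [P] is the eigenvector indexed by [ev i], on which [g] acts by [b g (ev i)]. *)
pose P : 'M[F]_#|[set: G]| := \matrix_(i, j) b (ev i) (- ev j).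
pose d g : 'rV[F]_#|[set: G]| := \row_i b g (ev i).
have uP : P \in unitmx.
  (* Fourier inversion: by orthogonality [Q] is inverse to [P]. *)
  pose Q : 'M[F]_#|[set: G]| := \matrix_(i, j) ((#|G|%:R)^-1 * b (ev i) (ev j)).
  suff /mulmx1_unit[] : P *m Q = 1%:M by [].
  apply/matrixP=> i j; rewrite !mxE.
  transitivity ((#|G|%:R)^-1 * \sum_x b (ev j - ev i) x).
    rewrite mulr_sumr (reindex ev) //=; last exact: onW_bij.
    apply: eq_bigr => k _; rewrite !mxE mulrCA (pairingDl perf_b).
    by congr (_ * _); rewrite mulrC (pairingNC perf_b) (pairingC perf_b (ev k)).
  rewrite (pairing_orthogonality perf_b) subr_eq0 (bij_eq ev_bij) eq_sym.
  by case: eqP => _; rewrite ?mulr0 // mulVf.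
have rGE g k j : rG g k j = (j == ix (ev k + g))%:R by rewrite !mxE eqxx.
have PrG g : P *m rG g = diag_mx (d g) *m P.
  apply/matrixP=> i j; rewrite mul_diag_mx !mxE.
  (* The regular action translates by [g], so column [j] of [rG g] has its only 1 in the row of
     [ev j - g]. *)
  rewrite (bigD1 (ix (ev j - g))) //= big1.
    rewrite rGE !mxE addr0 ixK subrK evK eqxx mulr1.
    by rewrite opprB (pairingDr perf_b) (pairingC perf_b g).
  move=> k nek; rewrite rGE; case: eqP => [jk|]; last by rewrite mulr0.
  by case/eqP: nek; rewrite jk ixK addrK evK.
rewrite (dim_ext_invariants_diag uP (in1W PrG)) /num_zero_sum_subsets.
pose im (S : {set 'I_#|[set: G]|}) : {set G} := ev @: S.
have im_bij : bijective im.
  exists (fun S : {set G} => ix @: S) => S; rewrite /im -imset_comp.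
    by rewrite (eq_imset _ evK) imset_id.
  by rewrite (eq_imset _ ixK) imset_id.
rewrite -(on_card_preimset (onW_bij _ im_bij)); apply: eq_card => S.
rewrite !inE big_imset => [|i j _ _]; last exact: (bij_inj ev_bij).
(* The eigenvalue of [g] at [S] is [b g] of the sum of [S]; it is 1 for all [g] exactly when the sum
   is 0, by nondegeneracy. *)
apply/forall_inP/eqP => [S1 | S0 g _].
  apply: (pairing_nondegenerate perf_b) => y.
  rewrite (pairingC perf_b) (pairing_sumr perf_b).
  rewrite -[RHS](eqP (S1 y (in_setT y))).
  by apply: eq_bigr => i _; rewrite mxE.
rewrite -[X in _ == X](pairing0r perf_b g) -S0 (pairing_sumr perf_b).
by apply/eqP/eq_bigr => i _; rewrite mxE.
Qed.

(** * Regrouping by element order, and the final formula *)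

Lemma sum_by_order (V : zmodType) (G : finZmodType) (f : nat -> V) :
  \sum_(x : G | odd #[x]%g) f #[x]%g
    = \sum_(d <- divisors #|G| | odd d) f d *+ num_elements_of_order G d.
Proof.
under [RHS]eq_bigr => d _.
  rewrite /num_elements_of_order -sumr_const; under eq_bigl do rewrite inE.
  rewrite big_mkcond; over.
rewrite exchange_big /= [LHS]big_mkcond; apply: eq_bigr => x _.
(* By Lagrange the order of [x] is one of the divisors summed over, so [x] contributes to exactly
   one term. *)
have dvx : #[x]%g \in divisors #|G|.
  have G_gt0 : (0 < #|G|)%N by apply/card_gt0P; exists 0.
  by rewrite -dvdn_divisors // -cardsT order_dvdG ?inE.
rewrite big_mkcond (bigD1_seq #[x]%g) ?divisors_uniq //= eqxx.
rewrite big1 ?addr0 // => d ned.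
by rewrite eq_sym (negPf ned) if_same.
Qed.

Local Open Scope complex_scope.

Theorem theorem4p4 (R : realType) (G : finZmodType) :
  num_zero_sum_subsets G
    = \dim (ext_invariants (regular_repr R[i] [set: G]%G)) /\
  (\dim (ext_invariants (regular_repr R[i] [set: G]%G)))%:R
    = (#|G|%:R)^-1 *
      \sum_(d <- divisors #|G| | odd d)
        (num_elements_of_order G d)%:R * 2 ^+ (#|G| %/ d) :> rat.
Proof.
have G_gt0 : (0 < #|G|)%N by apply/card_gt0P; exists 0.
have nzG (K : numFieldType) : #|G|%:R != 0 :> K by rewrite pnatr_eq0 -lt0n.
have [b perf_b] := perfect_pairing_exists (nzG R[i]).
rewrite (dim_ext_invariants_regular perf_b (nzG _)); split=> //.
apply: (mulfI (nzG _)); rewrite mulVKf ?nzG //.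
have := card_zero_sum_subsets_pairing perf_b.
rewrite -big_mkcond (sum_by_order _ (fun d => 2 ^+ (#|G| %/ d))) -natrM.
(* The pairing gives the identity in [R[i]]. Both sides are images of natural numbers, so
   characteristic 0 brings it down to [nat] and then to [rat]; hence the generality in [K]. *)
have natE (K : numFieldType) :
  \sum_(d <- divisors #|G| | odd d)
     2 ^+ (#|G| %/ d) *+ num_elements_of_order G d
    = (\sum_(d <- divisors #|G| | odd d)
         num_elements_of_order G d * 2 ^ (#|G| %/ d))%N%:R :> K.
  by rewrite natr_sum; apply: eq_bigr => d _; rewrite natrM natrX mulr_natl.
rewrite natE => /eqP; rewrite eqr_nat => /eqP eqN.
by rewrite -natrM eqN -natE; apply: eq_bigr => d _; rewrite mulr_natl.
Qed.
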